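(* Let $\Theta\subseteq\mathbb R$ be an open interval, $(\mathsf P_\theta)_{\theta\in\Theta}$ a family of probability measures on a measurable space on which random elements $E_1,E_2,\dots$ of some measurable space are defined that are i.i.d. with respect to each $\mathsf P_\theta$. Let $\theta_0\in\Theta$ and let $\Theta_0\subseteq\Theta$ be a neighborhood of $\theta_0$. For $j=1,2$ and each natural $n$ let $T_{j,n}$ be a real-valued statistic that is a function of $E_1,\dots,E_n$, and let $\mu_j,\sigma_j\colon\Theta_0\to\mathbb R$ be functions such that (i) $\sigma_j$ is continuous and strictly positive on $\Theta_0$; (ii) $(\mu_j(\theta)-\mu_j(\theta_0))(\theta-\theta_0)>0$ for all $\theta\in\Theta_0\setminus\{\theta_0\}$; (iii) with $Z_{j,n}(\theta):=\dfrac{T_{j,n}-\mu_j(\theta)}{\sigma_j(\theta)/\sqrt n}$, one has $\mathsf P_\theta(Z_{j,n}(\theta)\le z)\to\Phi(z)$ as $n\to\infty$, uniformly in $z\in\mathbb R$ and $\theta\in\Theta_0$. Let $\alpha,\beta>0$ with $\alpha+\beta<1$. Suppose that $n_1\in\mathbb N$, $n_2\in\mathbb N$ and $\vartheta\in\Theta$ vary together (say, along a sequence) so that $n_1\to\infty$, $n_2\to\infty$, $\vartheta\to\theta_0$ with $\vartheta>\theta_0$, and $$\mathsf P_\vartheta\big(Z_{j,n_j}(\theta_0)>z_\alpha\big)\to1-\beta\qquad\text{for } j=1,2.$$ Then for $j=1,2$ $$\sqrt{n_j}\sim (z_\alpha-z_{1-\beta})\Big/\frac{\mu_j(\vartheta)-\mu_j(\theta_0)}{\sigma_j(\theta_0)},$$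 and hence $$\frac{n_2}{n_1}\sim\frac{\sigma_2^2(\theta_0)}{\sigma_1^2(\theta_0)}\,\frac{\big(\mu_1(\vartheta)-\mu_1(\theta_0)\big)^2}{\big(\mu_2(\vartheta)-\mu_2(\theta_0)\big)^2}.$$
   Context: $\Phi$ is the standard normal cdf; $z_\gamma:=\Phi^{-1}(1-\gamma)$ for $\gamma\in(0,1)$. $A\sim B$ means $A/B\to1$. *)

(* Defs.v *)
From HB Require Import structures.
From mathcomp Require Import all_boot all_order all_algebra.
From mathcomp Require Import finmap.
From mathcomp Require Import all_classical all_reals all_analysis.

Set Implicit Arguments.
Unset Strict Implicit.
Unset Printing Implicit Defensive.

Import Order.TTheory GRing.Theory Num.Theory.
Import numFieldNormedType.Exports.

Local Open Scope classical_set_scope.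
Local Open Scope ring_scope.

Definition Phi (R : realType) (z : R) : R :=
  fine (normal_prob (0 : R) 1 `]-oo, z]).

(* z_gamma = Phi^-1 (1 - gamma). The solution of Phi z = 1 - gamma exists and
   is unique for 0 < gamma < 1; outside this range the value is irrelevant. *)
Definition zq (R : realType) (gamma : R) : R :=
  xget 0 [set z : R | Phi z = 1 - gamma].

(* A ~ B along the filter F, i.e. A / B --> 1. *)
Definition asymp_equiv (R : realType) (I : Type) (F : set_system I)
    (A B : I -> R) : Prop :=
  A i / B i @[i --> F] --> (1 : R).

(* The variables E k are independent (as a whole family, not just pairwise)
   and identically distributed under P. *)
Definition mutually_independent (d d' : measure_display)
    (Omega : measurableType d) (X : measurableType d') (R : realType)
    (P : probability Omega R) (E : nat -> Omega -> X) : Prop :=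
  forall (J : {fset nat}) (A : nat -> set X),
    (forall k, measurable (A k)) ->
    P (\bigcap_(k in [set` J]) (E k @^-1` A k))
      = (\prod_(k <- J) P (E k @^-1` A k))%E.

Definition identically_distributed (d d' : measure_display)
    (Omega : measurableType d) (X : measurableType d') (R : realType)
    (P : probability Omega R) (E : nat -> Omega -> X) : Prop :=
  forall (k l : nat) (A : set X), measurable A ->
    P (E k @^-1` A) = P (E l @^-1` A).

Definition iid (d d' : measure_display)
    (Omega : measurableType d) (X : measurableType d') (R : realType)
    (P : probability Omega R) (E : nat -> Omega -> X) : Prop :=
  mutually_independent P E /\ identically_distributed P E.

(* S is a (measurable) function of the first n observations E 0, .., E n.-1;
   n.-tuple X carries the product sigma-algebra. *)
Definition statistic (d d' : measure_display)
    (Omega : measurableType d) (X : measurableType d') (R : realType)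
    (E : nat -> Omega -> X) (n : nat) (S : Omega -> R) : Prop :=
  exists2 t : n.-tuple X -> R, measurable_fun setT t &
    forall w, S w = t [tuple E k w | k < n].

Definition Zstat (Omega : Type) (R : realType) (T : nat -> Omega -> R)
    (mu sigma : R -> R) (n : nat) (theta : R) (w : Omega) : R :=
  (T n w - mu theta) / (sigma theta / Num.sqrt n%:R).

(* Main.v *)
Require Import Defs.
From HB Require Import structures.
From mathcomp Require Import all_boot all_order all_algebra.
From mathcomp Require Import all_classical all_reals all_analysis.
From mathcomp Require Import measurable_realfun.
From mathcomp Require Import ring lra.

Import Order.TTheory GRing.Theory Num.Theory.
Import numFieldNormedType.Exports.

(* For each test, the event [z_alpha < Z_n(theta0)] is the complement of
   [Z_n(vartheta) <= c] with
   c = (sigma(theta0) z_alpha - (mu(vartheta) - mu(theta0)) sqrt n)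
       / sigma(vartheta).
   Uniformity of the normal approximation in both [z] and [theta] therefore
   turns the power condition into Phi(c) -> beta, and c -> z_(1-beta) because
   Phi is strictly increasing. As sigma(vartheta) -> sigma(theta0), this gives
   sqrt n (mu(vartheta) - mu(theta0)) / sigma(theta0)
     -> z_alpha - z_(1-beta), which is nonzero since 1 - alpha <> beta; the
   second claim is the squared quotient of these limits for j = 1, 2. *)

Local Open Scope classical_set_scope.
Local Open Scope ring_scope.

(** * The standard normal cdf and its quantiles *)

Lemma fin_num_normal_prob (R : realType) (A : set R) :
  measurable A -> normal_prob (0 : R) 1 A \is a fin_num.
Proof. by move=> mA; rewrite fin_num_measure. Qed.

Lemma Phi_diff (R : realType) (a b : R) : a <= b ->
  ((Phi b - Phi a)%:E =
    \int[lebesgue_measure]_(x in `]a, b]) (normal_pdf 0 1 x)%:E)%E.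
Proof.
move=> ab; rewrite /Phi EFinB !fineK ?fin_num_normal_prob//.
rewrite -[RHS]/(normal_prob 0 1 `]a, b]).
have -> : `]-oo, b]%classic = `]-oo, a]%classic `|` `]a, b]%classic.
  by rewrite -itv_bndbnd_setU.
rewrite measureU//; last first.
  rewrite -subset0 => x /=; rewrite !in_itv/= => -[xa /andP[]].
  by rewrite ltNge xa.
by rewrite addeAC subee ?add0e ?fin_num_normal_prob.
Qed.

(** The density is at most its peak value [normal_peak 1], so its integral over []a, b]] is at most
    the peak times the length. This supplies the Lipschitz constant for the continuity of [Phi]. *)
Lemma Phi_diff_le (R : realType) (a b : R) : a <= b ->
  Phi b - Phi a <= normal_peak 1 * (b - a).
Proof.
move=> ab; rewrite -lee_fin Phi_diff//.
have -> : (normal_peak 1 * (b - a))%:E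
    = (\int[lebesgue_measure]_(x in `]a, b]) (normal_peak (1 : R))%:E)%E.
  rewrite integral_cst//= lebesgue_measure_itv/= lte_fin.
  move: ab; rewrite le_eqVlt => /predU1P[->|ab].
    by rewrite ltxx subrr mulr0 mule0.
  by rewrite ab EFinM EFinB.
apply: ge0_le_integral => //=.
- by move=> x _; rewrite lee_fin normal_pdf_ge0.
- by apply/measurable_EFinP/measurable_funTS; exact: measurable_normal_pdf.
- by move=> x _; rewrite lee_fin normal_pdf_ub.
Qed.

(** The increment is the integral of a density that is bounded below on []a, b]] by a positive
    constant. *)
Lemma ltr_Phi (R : realType) (a b : R) : a < b -> Phi a < Phi b.
Proof.
move=> ab; rewrite -subr_gt0 -lte_fin Phi_diff ?ltW//.
(* Every [x] in []a, b]] has [x ^+ 2 <= a ^+ 2 + b ^+ 2], whatever the signs of [a] and [b], so [c]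
   is a lower bound of the density there. *)
pose c : R := normal_peak 1 * expR (- (a ^+ 2 + b ^+ 2) / 2).
have c0 : 0 < c by rewrite mulr_gt0 ?expR_gt0// normal_peak_gt0.
apply: (@lt_le_trans _ _ (c * (b - a))%:E).
  by rewrite lte_fin mulr_gt0// subr_gt0.
have -> : (c * (b - a))%:E = (\int[lebesgue_measure]_(x in `]a, b]) c%:E)%E.
  by rewrite integral_cst//= lebesgue_measure_itv/= lte_fin ab EFinM EFinB.
apply: ge0_le_integral => //=.
- by move=> x _; rewrite lee_fin ltW.
- by apply/measurable_EFinP/measurable_funTS; exact: measurable_normal_pdf.
- move=> x; rewrite in_itv/= => /andP[ax xb].
  rewrite lee_fin normal_pdfE ?oner_eq0// ler_wpM2l ?normal_peak_ge0//.
  have xab : x ^+ 2 <= a ^+ 2 + b ^+ 2 by have [x0|x0] := leP 0 x; nra.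
  by rewrite /normal_fun ler_expR subr0 expr1n; lra.
Qed.

Lemma continuous_Phi (R : realType) : continuous (@Phi R).
Proof.
have Phi_lip (x y : R) : `|Phi x - Phi y| <= normal_peak 1 * `|x - y|.
  wlog xy : x y / y <= x => [H|].
    by have [|/ltW] := leP y x; [|rewrite distrC (distrC x)]; exact: H.
  rewrite ger0_norm; first by rewrite ger0_norm ?subr_ge0// Phi_diff_le.
  by rewrite subr_ge0; move: xy; rewrite le_eqVlt => /predU1P[->//|/ltr_Phi/ltW].
move=> x; apply/cvgrPdist_le => e e0.
have p0 : 0 < normal_peak (1 : R) by exact: normal_peak_gt0.
have /cvgrPdist_le/(_ (e / normal_peak 1)) : y @[y --> x] --> x by exact: cvg_id.
rewrite divr_gt0// => /(_ isT); apply: filterS => y xy.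
by rewrite (le_trans (Phi_lip _ _))// mulrC -ler_pdivlMr.
Qed.

(** The limits 0 and 1 of [Phi] at the two infinities bracket [1 - g], and the intermediate value
    theorem gives a solution; hence [xget] returns a solution and not its default 0. *)
Lemma Phi_zq (R : realType) (g : R) : 0 < g < 1 -> Phi (zq g) = 1 - g.
Proof.
move=> /andP[g0 g1].
have mid : measurable_fun [set: measurableTypeR R] (idfun : _ -> R).
  exact: measurable_id.
(* The identity, seen as a random variable under the normal law, has cdf [Phi], so the general
   limits of a cdf apply. *)
pose X : {RV (normal_prob (0 : R) 1) >-> R} :=
  @mfun_Sub _ _ (measurableTypeR R) R (idfun : measurableTypeR R -> R)
    (mem_set mid).
have [a Pa] : exists a, Phi a < 1 - g.
  have PhiNy : Phi z @[z --> -oo] --> (0 : R) by exact: fine_cvg (cvg_cdfNy0 X).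
  by apply: filter_ex (cvgr_lt _ PhiNy _ _); rewrite subr_gt0.
have [b Pb] : exists b, 1 - g < Phi b.
  have Phiy : Phi z @[z --> +oo] --> (1 : R) by exact: fine_cvg (cvg_cdfy1 X).
  by apply: filter_ex (cvgr_gt _ Phiy _ _); rewrite gtrBl.
have Pab := lt_trans Pa Pb.
have ab : a <= b.
  by rewrite leNgt; apply/negP => /ltr_Phi/(lt_trans Pab); rewrite ltxx.
have cPhi := continuous_subspaceT (@continuous_Phi R).
have [|c _ Pc] := @IVT R (@Phi R) a b (1 - g) ab (cPhi _).
  by rewrite minEle maxEle (ltW Pab) (ltW Pa) (ltW Pb).
by rewrite /zq; case: xgetP => [z _ //|/(_ c)].
Qed.

(** Plays the role of continuity of the inverse of [Phi] at [Phi b]: eventually [Phi (c i)] lies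
    strictly between [Phi (b - e)] and [Phi (b + e)], and monotonicity traps [c i]. *)
Lemma cvg_Phi_inj (R : realType) (I : Type) (F : set_system I)
    (FF : Filter F) (c : I -> R) (b : R) :
  Phi (c i) @[i --> F] --> Phi b -> c @ F --> b.
Proof.
have Phi_lt (x y : R) : Phi x < Phi y -> x < y.
  case: (ltgtP x y) => // [/ltr_Phi/ltW yx|->]; last by rewrite ltxx.
  by rewrite ltNge yx.
move=> h; apply/cvgrPdist_lt => e e0.
have h1 : \forall i \near F, Phi (c i) < Phi (b + e).
  by apply: (cvgr_lt _ h); apply: ltr_Phi; rewrite ltrDl.
have h2 : \forall i \near F, Phi (b - e) < Phi (c i).
  by apply: (cvgr_gt _ h); apply: ltr_Phi; rewrite gtrBl.
near=> i.
have l1 : c i < b + e by apply: Phi_lt; near: i.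
have l2 : b - e < c i by apply: Phi_lt; near: i.
by rewrite distrC ltr_distl l1 l2.
Unshelve. all: by end_near. Qed.

(** * Test events and their measurability *)

Lemma Zstat_shift (Omega : Type) (R : realType) (T : nat -> Omega -> R)
    (mu sigma : R -> R) (n : nat) (theta0 theta z : R) :
  (0 < n)%N -> 0 < sigma theta0 -> 0 < sigma theta ->
  [set w | z < Zstat T mu sigma n theta0 w] =
  ~` [set w | Zstat T mu sigma n theta w <=
        (sigma theta0 * z - (mu theta - mu theta0) * Num.sqrt n%:R)
        / sigma theta].
Proof.
move=> n0 s0 s1; have r0 : 0 < Num.sqrt n%:R :> R by rewrite sqrtr_gt0 ltr0n.
(* Clearing the positive denominators turns both events into comparisons of [T n w] with the same
   number [mu theta0 + z * (sigma theta0 / Num.sqrt n%:R)]. *)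
apply/seteqP; split => w /=; rewrite /Zstat ltr_pdivlMr ?divr_gt0//;
  rewrite ler_pdivrMr ?divr_gt0//;
  (rewrite [leRHS](_ : _ = z * (sigma theta0 / Num.sqrt n%:R)
     - (mu theta - mu theta0)); last by field; rewrite !gt_eqF).
- by move=> H; apply/negP; rewrite -ltNge; lra.
- by move=> /negP; rewrite -ltNge; lra.
Qed.

Lemma measurable_statistic (d d' : measure_display)
    (Omega : measurableType d) (X : measurableType d') (R : realType)
    (E : nat -> Omega -> X) (n : nat) (S : Omega -> R) :
  (forall k, measurable_fun setT (E k)) -> statistic E n S ->
  measurable_fun setT S.
Proof.
move=> mE [t mt /funext ->]; apply: measurableT_comp => //.
apply/measurable_fun_tnthP => i.
by apply: eq_measurable_fun (mE i) => w _ /=; rewrite tnth_mktuple.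
Qed.

Lemma measurable_Zstat_le (d : measure_display) (Omega : measurableType d)
    (R : realType) (T : nat -> Omega -> R) (mu sigma : R -> R) (n : nat)
    (theta z : R) : measurable_fun setT (T n) ->
  measurable [set w | Zstat T mu sigma n theta w <= z].
Proof.
move=> mT; rewrite -[X in measurable X]setTI.
have mZ : measurable_fun setT (Zstat T mu sigma n theta).
  by apply: measurable_funM => //; exact: measurable_funB.
by have := mZ measurableT `]-oo, z]%classic (measurable_itv _);
  congr measurable; apply/seteqP; split => w /=; rewrite in_itv.
Qed.

(** Stated for one test and as a product: both claims of the theorem follow from this limit by
    division. *)
Lemma cvg_sqrt_sample_size (d : measure_display) (Omega : measurableType d)
    (R : realType) (P : R -> probability Omega R) (theta0 : R)
    (Theta0 : set R) (T : nat -> Omega -> R) (mu sigma : R -> R)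
    (alpha beta : R) (I : Type) (F : set_system I) (FF : Filter F)
    (n : I -> nat) (vartheta : I -> R) :
  nbhs theta0 Theta0 ->
  (forall m, measurable_fun setT (T m)) ->
  {within Theta0, continuous sigma} ->
  (forall theta, Theta0 theta -> 0 < sigma theta) ->
  (forall eps : R, 0 < eps ->
     \forall m \near \oo, forall theta (z : R), Theta0 theta ->
       `|fine (P theta [set w | Zstat T mu sigma m theta w <= z])
         - Phi z| < eps) ->
  0 < beta < 1 ->
  n @ F --> \oo ->
  vartheta @ F --> theta0 ->
  fine (P (vartheta i) [set w | zq alpha < Zstat T mu sigma (n i) theta0 w])
    @[i --> F] --> 1 - beta ->
  Num.sqrt (n i)%:R * ((mu (vartheta i) - mu theta0) / sigma theta0)
    @[i --> F] --> zq alpha - zq (1 - beta).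
Proof.
move=> nTheta0 mT csigma sigma0 unif beta01 n_oo cvg_v power.
have Th0 : Theta0 theta0 by exact: nbhs_singleton.
have s0 : 0 < sigma theta0 by exact: sigma0.
have Thv : \forall i \near F, Theta0 (vartheta i) by exact: cvg_v.
have n_gt0 : \forall i \near F, (0 < n i)%N by exact: (n_oo _ (nbhs_infty_gt 0)).
(* [theta0] is interior to [Theta0], so continuity within [Theta0] is ordinary continuity at
   [theta0]. *)
have csv : sigma (vartheta i) @[i --> F] --> sigma theta0.
  apply: (cvg_comp _ _ cvg_v).
  by have /subspace_continuousP/(_ _ Th0) := csigma; rewrite within_interior.
pose c i := (sigma theta0 * zq alpha
  - (mu (vartheta i) - mu theta0) * Num.sqrt (n i)%:R) / sigma (vartheta i).
have cvgPhi : Phi (c i) @[i --> F] --> Phi (zq (1 - beta)).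
  rewrite Phi_zq; last by rewrite subr_gt0 gtrBl andbC.
  rewrite subKr.
  apply/cvgrPdist_lt => e e0.
  have e20 : 0 < e / 2 by rewrite divr_gt0.
  have /cvgrPdist_lt/(_ _ e20) pow := power.
  (* The bound holds for all [theta] and [z] once [m] is large, so both may move with [i]: take
     [m = n i], [theta = vartheta i], [z = c i]. *)
  have uni : \forall i \near F, Theta0 (vartheta i) ->
      `|fine (P (vartheta i) [set w |
          Zstat T mu sigma (n i) (vartheta i) w <= c i]) - Phi (c i)| < e / 2.
    have := n_oo _ (unif _ e20).
    rewrite nbhs_filterE /fmap/=; apply: filterS => i H; exact: H.
  near=> i.
  have Thi : Theta0 (vartheta i) by near: i.
  have ni : (0 < n i)%N by near: i.
  have h1 : `|fine (P (vartheta i) [set w |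
      Zstat T mu sigma (n i) (vartheta i) w <= c i]) - Phi (c i)| < e / 2.
    by move: Thi; near: i.
  have : `|1 - beta - fine (P (vartheta i)
     [set w | zq alpha < Zstat T mu sigma (n i) theta0 w])| < e / 2 by near: i.
  (* Passing to the complement, the power condition says that the probability of [Z <= c i] is
     within [e / 2] of [beta]; by [h1] it is also within [e / 2] of [Phi (c i)]. *)
  rewrite (@Zstat_shift _ _ _ _ _ _ _ (vartheta i))//; last exact: sigma0.
  rewrite probability_setC; last exact: measurable_Zstat_le.
  rewrite -/(c i) fineB ?fin_num_measure//; last first.
    exact: measurable_Zstat_le.
  rewrite /= => h2; move: h1 h2; rewrite !ltr_norml => /andP[? ?] /andP[? ?].
  by apply/andP; split; lra.
have cc : c @ F --> zq (1 - beta) by exact: cvg_Phi_inj cvgPhi.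
(* A factor equal to 1 is inserted to give the limit the shape of the product in [main]. *)
have -> : zq alpha - zq (1 - beta)
    = zq alpha - zq (1 - beta) * (sigma theta0 / sigma theta0).
  by rewrite divff ?mulr1// gt_eqF.
have main : zq alpha - c i * (sigma (vartheta i) / sigma theta0) @[i --> F] -->
    zq alpha - zq (1 - beta) * (sigma theta0 / sigma theta0).
  by apply: cvgB; [exact: cvg_cst|apply: cvgM => //; apply: cvgMl].
(* Solving the definition of [c i] for the scaled mean shift shows that the two sequences agree
   wherever [sigma (vartheta i)] is positive. *)
apply: cvg_trans main; apply: near_eq_cvg; near=> i.
have s1 : 0 < sigma (vartheta i) by apply: sigma0; near: i.
by rewrite /c; field; rewrite !gt_eqF.
Unshelve. all: by end_near. Qed.

Theorem mainTheorem2
  (R : realType) (dO dX : measure_display)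
  (Omega : measurableType dO) (X : measurableType dX)
  (Theta : set R) (P : R -> probability Omega R) (E : nat -> Omega -> X)
  (theta0 : R) (Theta0 : set R)
  (T : 'I_2 -> nat -> Omega -> R) (mu sigma : 'I_2 -> R -> R)
  (alpha beta : R)
  (I : Type) (F : set_system I) (n : 'I_2 -> I -> nat) (vartheta : I -> R)
  (open_Theta : open Theta) (itv_Theta : is_interval Theta)
  (meas_E : forall k, measurable_fun [set: Omega] (E k))
  (iid_E : forall theta, Theta theta -> iid (P theta) E)
  (Theta_theta0 : Theta theta0)
  (sub_Theta0 : Theta0 `<=` Theta) (nbhs_Theta0 : nbhs theta0 Theta0)
  (stat_T : forall j m, statistic E m (T j m))
  (cont_sigma : forall j, {within Theta0, continuous (sigma j)})
  (pos_sigma : forall j theta, Theta0 theta -> 0 < sigma j theta)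
  (mono_mu : forall j theta, (Theta0 `\ theta0) theta ->
     0 < (mu j theta - mu j theta0) * (theta - theta0))
  (unif_Z : forall j (eps : R), 0 < eps ->
     \forall m \near \oo, forall theta (z : R), Theta0 theta ->
       `|fine (P theta [set w | Zstat (T j) (mu j) (sigma j) m theta w <= z])
         - Phi z| < eps)
  (alpha_gt0 : 0 < alpha) (beta_gt0 : 0 < beta)
  (alpha_beta : alpha + beta < 1)
  (FF : ProperFilter F)
  (n_oo : forall j, n j @ F --> \oo)
  (Theta_vartheta : forall i, Theta (vartheta i))
  (gt_vartheta : forall i, theta0 < vartheta i)
  (cvg_vartheta : vartheta @ F --> theta0)
  (power : forall j,
     fine (P (vartheta i)
       [set w | zq alpha < Zstat (T j) (mu j) (sigma j) (n j i) theta0 w])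
     @[i --> F] --> 1 - beta) :
  (forall j, asymp_equiv F
     (fun i => Num.sqrt (n j i)%:R)
     (fun i => (zq alpha - zq (1 - beta))
               / ((mu j (vartheta i) - mu j theta0) / sigma j theta0)))
  /\
  asymp_equiv F
    (fun i => (n ord_max i)%:R / (n ord0 i)%:R)
    (fun i => sigma ord_max theta0 ^+ 2 / sigma ord0 theta0 ^+ 2
              * ((mu ord0 (vartheta i) - mu ord0 theta0) ^+ 2
                 / (mu ord_max (vartheta i) - mu ord_max theta0) ^+ 2)).

Proof.
have alpha01 : 0 < alpha < 1 by apply/andP; split => //; lra.
have beta01 : 0 < beta < 1 by apply/andP; split => //; lra.
have cvg_sqrt j : Num.sqrt (n j i)%:R
    * ((mu j (vartheta i) - mu j theta0) / sigma j theta0) @[i --> F]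
    --> zq alpha - zq (1 - beta).
  apply: (@cvg_sqrt_sample_size _ _ _ P theta0 Theta0 _ _ _ alpha beta) => //.
  - by move=> m; exact: measurable_statistic meas_E (stat_T j m).
  - exact: pos_sigma.
  - exact: unif_Z.
(* Equal quantiles would give [1 - alpha = beta] after applying [Phi], against
   [alpha + beta < 1]. *)
have zq_neq : zq alpha - zq (1 - beta) != 0.
  rewrite subr_eq0; apply/eqP => /(congr1 (@Phi R)).
  by rewrite !Phi_zq//; lra.
move: cvg_sqrt zq_neq; set c := _ - _ => cvg_sqrt c_neq0.
split=> [j|]; rewrite /asymp_equiv.
- have lim : Num.sqrt (n j i)%:R
      * ((mu j (vartheta i) - mu j theta0) / sigma j theta0)
      / c @[i --> F] --> (1 : R).
    by rewrite -[X in _ --> X](divff c_neq0); apply: cvgM;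
      [exact: cvg_sqrt|exact: cvg_cst].
  apply: cvg_trans lim; apply: near_eq_cvg; near=> i.
  by rewrite /= invfM invrK [c^-1 * _]mulrC -mulrA.
- pose ratio i := Num.sqrt (n ord_max i)%:R
      * ((mu ord_max (vartheta i) - mu ord_max theta0) / sigma ord_max theta0)
      / (Num.sqrt (n ord0 i)%:R
      * ((mu ord0 (vartheta i) - mu ord0 theta0) / sigma ord0 theta0)).
  have lim : ratio i @[i --> F] --> (1 : R).
    rewrite -[X in _ --> X](divff c_neq0); apply: cvgM; first exact: cvg_sqrt.
    by apply: cvgV => //; exact: cvg_sqrt.
  have lim2 : ratio i * ratio i @[i --> F] --> (1 : R).
    by rewrite -[X in _ --> X](mulr1 1); apply: cvgM.
  apply: cvg_trans lim2; apply: near_eq_cvg; near=> i.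
  (* Writing each sample size as the square of its root makes the target quotient equal to
     [ratio i * ratio i]. *)
  rewrite /ratio -[in RHS](@sqr_sqrtr _ (n ord_max i)%:R)//.
  rewrite -[in RHS](@sqr_sqrtr _ (n ord0 i)%:R)// !invfM !invrK; ring.
Unshelve. all: by end_near. Qed.
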